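(* Let $n<\omega$, let $\mathcal{A}=(A,E_1,\dots,E_n)$ be a countable nested $n$-equivalence structure, let $E_0=A\times A$ and let $E_{n+1}$ be equality on $A$. Then the following are equivalent: (1) $\mathcal{A}$ is ultrahomogeneous. (2) For each $i$ with $0\le i\le n$ there exists $k_i$ (a cardinal $\le\aleph_0$) such that every $E_i$ class is partitioned into $k_i$ many $E_{i+1}$ classes. (3) $T_{\mathcal{A}}$ is ultrahomogeneous in the predecessor representation.
   Context: An $n$-equivalence structure is a structure $(A,E_1,\dots,E_n)$ where each $E_i$ is an equivalence relation on $A$; it is nested if $E_j\subseteq E_i$ whenever $i<j\le n$. $[a]_i$ denotes the $E_i$ class of $a$. The tree $T_{\mathcal{A}}$ has as nodes the equivalence classes $[a]_i$ for $a\in A$ and $0\le i\le n+1$, where classes at different levels $i$ are regarded as distinct nodes even if equal as sets (i.e. nodes are pairs $(i,[a]_i)$). The root is $[a]_0=A$, and for each $a$ and each $i\le n$, $[a]_i$ is the predecessor of $[a]_{i+1}$; the root is its own predecessor. In the predecessor representation, $T_{\mathcal{A}}$ is the structure $(T_{\mathcal{A}},f)$ with $f$ the unary predecessor function. A structure is ultrahomogeneous if every isomorphism between finitely generated substructures extends to an automorphism of the structure. *)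

(* Defs.v *)
From mathcomp Require Import all_boot.
From mathcomp Require Import boolp classical_sets functions cardinality.
From Stdlib Require Export RelationClasses.

Set Implicit Arguments.
Unset Strict Implicit.
Unset Printing Implicit Defensive.

Local Open Scope classical_set_scope.

Record language := Language {
  fsym : Type;
  farity : fsym -> nat;
  rsym : Type;
  rarity : rsym -> nat }.

Record structure (L : language) := Structure {
  carrier :> Type;
  finterp : forall f : fsym L, (farity f).-tuple carrier -> carrier;
  rinterp : forall r : rsym L, (rarity r).-tuple carrier -> Prop }.

Section Ultrahomogeneity.
Variables (L : language) (M : structure L).

Definition is_substructure (B : set M) : Prop :=
  forall (f : fsym L) (t : (farity f).-tuple M),
    (forall i, B (tnth t i)) -> B (finterp t).

Definition generated (X : set M) : set M := smallest is_substructure X.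

Definition fg_substructure (B : set M) : Prop :=
  exists2 X : set M, finite_set X & B = generated X.

(* An isomorphism from the substructure B onto the substructure C is the
   restriction to B of a total map h, whose values outside B are irrelevant. *)
Definition isomorphism (B C : set M) (h : M -> M) : Prop :=
  [/\ set_bij B C h,
      forall (f : fsym L) (t : (farity f).-tuple M),
        (forall i, B (tnth t i)) -> h (finterp t) = finterp (map_tuple h t) &
      forall (r : rsym L) (t : (rarity r).-tuple M),
        (forall i, B (tnth t i)) -> (rinterp t <-> rinterp (map_tuple h t))].

Definition automorphism (g : M -> M) : Prop := isomorphism setT setT g.

Definition ultrahomogeneous : Prop :=
  forall (B C : set M) (h : M -> M),
    fg_substructure B -> fg_substructure C -> isomorphism B C h ->
    exists2 g : M -> M, automorphism g & {in B, g =1 h}.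

End Ultrahomogeneity.

Section EquivalenceStructures.
Variables (n : nat) (A : Type).

(* The relation written E_(i+1) on paper is indexed here by i : 'I_n. *)
Variable E : 'I_n -> A -> A -> Prop.

Definition eqstr_language : language :=
  @Language void (fun=> 0) 'I_n (fun=> 2).

Definition eqstr : structure eqstr_language :=
  @Structure eqstr_language A
    (fun f => match f with end)
    (fun (i : 'I_n) (t : 2.-tuple A) => E i (tnth t ord0) (tnth t ord_max)).

Definition is_nested : Prop :=
  forall (i j : 'I_n) (x y : A), i < j -> E j x y -> E i x y.

(* The sequence E_0, E_1, ..., E_n, E_(n+1) with its paper indexing: E_0 is the
   full relation and E_(n+1) is equality (indices above n+1 are not used). *)
Definition erel (i : nat) (x y : A) : Prop :=
  match i with
  | 0 => True
  | j.+1 => if insub j is Some k then E k x y else x = y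
  end.

Definition eclass (i : nat) (a : A) : set A := [set b | erel i a b].

Definition subclasses (i : nat) (a : A) : set (set A) :=
  [set eclass i.+1 b | b in eclass i a].

Record tree_node := TreeNode {
  level : 'I_n.+2;
  node_class : set A;
  node_classP : exists a : A, node_class = eclass level a }.

Definition node (i : 'I_n.+2) (a : A) : tree_node :=
  TreeNode (ex_intro (fun b => eclass i a = eclass i b) a erefl).

(* The predecessor of (i, [a]_i) is (i-1, [a]_(i-1)), with 0-1 = 0; the choice
   of the representative a is irrelevant by tree_pred_node below. *)
Definition tree_pred (x : tree_node) : tree_node :=
  node (inord (level x).-1) (projT1 (cid (node_classP x))).

Definition tree_language : language :=
  @Language unit (fun=> 1) void (fun=> 0).

Definition tree : structure tree_language :=
  @Structure tree_language tree_node
    (fun _ (t : 1.-tuple tree_node) => tree_pred (thead t))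
    (fun r => match r with end).

Hypotheses (equivE : forall i, Equivalence (E i)) (nestedE : is_nested).

Lemma erel_equiv i : Equivalence (erel i).
Proof.
case: i => [|j]; first by split.
rewrite /erel.
case: (insubP 'I_n j) => [k _ _|_]; first exact: equivE.
by split=> [x|x y ->|x y z -> ->].
Qed.

Lemma erel_pred i x y : erel i x y -> erel i.-1 x y.
Proof.
case: i => [//|[//|j]] /=.
case: (insubP 'I_n j.+1) => [k _ kj|_] Exy; case: (insubP 'I_n j) => [l _ lj|].
- by apply: nestedE Exy; rewrite lj kj.
- by have := ltn_ord k; rewrite [nat_of_ord k]kj => /ltnW ->.
- by rewrite Exy; have [refl _ _] := equivE l; apply: refl.
- by [].
Qed.

Lemma eclass_eq i x y : erel i x y -> eclass i x = eclass i y.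
Proof.
have [_ sym trans] := erel_equiv i => xy.
apply/seteqP; split=> z /=; last exact: trans.
by apply: trans; apply: sym.
Qed.

Lemma eq_tree_node (x y : tree_node) :
  level x = level y -> node_class x = node_class y -> x = y.
Proof.
case: x y => [i C hC] [j D hD] /= ij CD; subst j D.
by congr TreeNode; apply: Prop_irrelevance.
Qed.

Lemma tree_pred_node (i : 'I_n.+2) a :
  tree_pred (node i a) = node (inord i.-1) a.
Proof.
rewrite /tree_pred; case: cid => b /= iab; apply: eq_tree_node => //=.
have [refl sym _] := erel_equiv i.
rewrite inordK; last exact: leq_ltn_trans (leq_pred _) (ltn_ord i).
apply/eclass_eq/erel_pred.
by have : eclass i b b := refl b; rewrite -iab; apply: sym.
Qed.

End EquivalenceStructures.

(* A cardinal k <= aleph_0 is given by a standard set of that cardinality: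
   Some m stands for m and None for aleph_0. *)
Definition card_rep (k : option nat) : set nat :=
  if k is Some m then `I_m else setT.

(* Main.v *)
Require Import Defs.
From mathcomp Require Import all_boot.
From mathcomp Require Import boolp classical_sets functions cardinality.
Local Open Scope classical_set_scope.
Local Open Scope card_scope.

(** Both structures record the same branching data, and homogeneity of either
    amounts to that data depending on the level only.

    From homogeneity to the cardinals: the one-point isomorphism a |-> b
    extends to an automorphism for all points a and b, and an automorphism
    carries the classes inside the E_i class of a bijectively onto
    those inside the E_i class of b ([cardinals_of_ultrahomogeneous]).  So the
    number of subclasses does not depend on the class, and it is at most
    aleph_0 because A is countable.

    From the cardinals to the tree: the children of the node (i, [a]_i) are
    the E_(i+1) classes inside [a]_i, so two nodes of the same level have
    equinumerous sets of children.  A partial isomorphism h between finite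
    subtrees preserves levels ([partial_iso_level]) and is extended from the
    root upwards: once the image of a node x is known, the children of x are
    sent to the children of the image by a bijection that agrees with h where h
    is defined ([extend_partial_iso]).  Such a bijection exists because a
    bijection can be corrected at finitely many points by transpositions
    ([extend_set_bij]).

    From the tree back to the equivalence structure: points of A are the leaves
    of the tree, and E_i a b holds exactly when the ancestors of a and b at
    level i coincide.  A finite partial isomorphism of the equivalence structure
    therefore acts on the ancestors of its domain ([nodes_iso]), and an
    automorphism of the tree acts on the leaves as an automorphism of the
    equivalence structure ([tree_automorphism_leaves]). *)

Set Implicit Arguments.
Unset Strict Implicit.

(** * Correcting a bijection at finitely many points *)

(** The bijection has to be total on T, so it needs a value outside X: the map h
    provides one, and it is itself the bijection when X is empty. *)
Lemma card_eq_set_bij (T U : Type) (h : T -> U) (X : set T) (Y : set U) :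
  X #= Y -> exists f, set_bij X Y f.
Proof.
move=> XY; have [eX|/set0P[x Xx]] := eqVneq X set0.
  exists h; move: XY; rewrite eX card_eq_sym card_eq0 => /eqP ->.
  by split=> // x; rewrite in_setE.
have /card_eqP[f] := XY.
by exists (valLR (h x) f); exact: bij.
Qed.

Definition swap (T : Type) (a b z : T) : T :=
  if pselect (z = a) then b else if pselect (z = b) then a else z.

Lemma swapL (T : Type) (a b : T) : swap a b a = b.
Proof. by rewrite /swap; case: pselect. Qed.

Lemma swap_id (T : Type) (a b z : T) : z <> a -> z <> b -> swap a b z = z.
Proof. by rewrite /swap; do 2 case: pselect. Qed.

Lemma swapR (T : Type) (a b : T) : swap a b b = a.
Proof. by rewrite /swap; case: pselect => [//|nba]; case: pselect. Qed.

Lemma swapK (T : Type) (a b : T) : involutive (swap a b).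
Proof.
move=> z; have [->|za] := pselect (z = a); first by rewrite swapL swapR.
have [->|zb] := pselect (z = b); first by rewrite swapR swapL.
by rewrite !swap_id.
Qed.

Lemma swap_bij (T : Type) (Y : set T) (a b : T) :
  Y a -> Y b -> set_bij Y Y (swap a b).
Proof.
move=> Ya Yb.
have mapY : set_fun Y Y (swap a b).
  by move=> z Yz; rewrite /swap; do 2 case: pselect.
split=> // [x y _ _|y Yy]; first exact: (inv_inj (swapK a b)).
exists (swap a b y); [exact: mapY|exact: swapK].
Qed.

(** By induction on F: a bijection that agrees with h on a part of F is composed
    with the transposition of its value at the next point x and h x.  Both h and
    the bijection are injective, so the values at the earlier points are neither
    of the two and do not move.  The argument is uniform in the cardinality
    of X. *)
Lemma extend_set_bij (T U : Type) (X F : set T) (Y : set U) (h : T -> U) :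
  X #= Y -> finite_set F -> F `<=` X -> set_fun F Y h -> set_inj F h ->
  exists2 f, set_bij X Y f & {in F, f =1 h}.
Proof.
move=> XY /(@finite_seqP {classic T})[s ->{F}].
elim: s => [|x s IHs] sX hY hI.
  by have [f fXY] := card_eq_set_bij h XY; exists f => // z; rewrite in_setE.
have sub z : [set` s] z -> [set` x :: s] z.
  by rewrite /= inE => ->; rewrite orbT.
have [||z w|f fXY fh] := IHs.
- by move=> z /sub; apply: sX.
- by move=> z /sub; apply: hY.
- by rewrite !in_setE => /sub zs /sub ws; apply: hI; rewrite in_setE.
have xs : [set` x :: s] x by rewrite /= inE eqxx.
have [xin|xnin] := boolP (x \in s).
  exists f => // z; rewrite in_setE /= inE => /orP[/eqP ->|zs].
    by apply: fh; rewrite in_setE.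
  by apply: fh; rewrite in_setE.
have [fX fI _] := fXY.
exists (swap (f x) (h x) \o f).
  by apply: set_bij_comp fXY _; apply: swap_bij; [apply/fX/sX|apply: hY].
move=> z; rewrite in_setE /= inE => /orP[/eqP ->|zs]; first exact: swapL.
have zx : z <> x by move=> zx; move: xnin; rewrite -zx zs.
have zs' := sub _ zs.
have fz : f z = h z by apply: fh; rewrite in_setE.
rewrite /= swap_id fz // => hz; apply: zx.
  by apply: fI; rewrite ?in_setE ?fz//; apply: sX.
by apply: hI; rewrite ?in_setE.
Qed.

(** * Partial isomorphisms of levelled trees *)

Section LevelledTree.
Variables (T : Type) (lev : T -> nat) (parent : T -> T).
Hypothesis levP : forall x, lev (parent x) = (lev x).-1.
Hypothesis rootP : forall x y, lev x = 0 -> lev y = 0 -> x = y.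

Definition children (x : T) : set T :=
  [set y | lev y = (lev x).+1 /\ parent y = x].

Lemma level_ind (P : T -> Prop) :
  (forall x, lev x = 0 -> P x) ->
  (forall x y, children x y -> P x -> P y) -> forall x, P x.
Proof.
move=> P0 PS x; move ex: (lev x) => k; elim: k x ex => [|k IHk] y ey.
  exact: P0.
by apply: (PS (parent y)); [split=> //|apply: IHk]; rewrite levP ey.
Qed.

Lemma parent_root x : lev x = 0 -> parent x = x.
Proof. by move=> x0; apply: rootP => //; rewrite levP x0. Qed.

Lemma child_neq x y : children x y -> x <> y.
Proof. by move=> [+ _] xy; rewrite xy => /eqP; rewrite eqn_leq ltnn andbF. Qed.

Section Extension.
Variables (B : set T) (h : T -> T).
Hypothesis B_parent : forall x, B x -> B (parent x).
Hypothesis hI : set_inj B h.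
Hypothesis h_parent : forall x, B x -> h (parent x) = parent (h x).

(** The root is the only node that is its own parent, so h maps it to the root;
    every other node lies one level above its parent.  Injectivity excludes that
    a child of the root is sent to the root as well. *)
Lemma partial_iso_level x : B x -> lev (h x) = lev x.
Proof.
have fixed y : parent y = y -> lev y = 0.
  move=> yy; have := levP y; rewrite yy; case: (lev y) => //= k /eqP.
  by rewrite eqn_leq ltnn.
move: x; apply: level_ind => [x x0 Bx|x y xy IHx By].
  by rewrite x0; apply: fixed; rewrite -h_parent// parent_root.
have [yS yx] := xy.
have Bx : B x by rewrite -yx; apply: B_parent.
have hxy : h x = parent (h y) by rewrite -h_parent// yx.
have := levP (h y); rewrite -hxy IHx// yS.
case ehy: (lev (h y)) => [|k] /= -> //.
case: (child_neq xy); apply: hI; rewrite ?in_setE//.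
by rewrite hxy parent_root.
Qed.

Hypothesis cardP : forall x y, lev x = lev y -> children x #= children y.
Hypothesis finB : finite_set B.

Lemma children_bij x y : lev x = lev y -> exists phi,
  set_bij (children x) (children y) phi /\
  (B x -> y = h x -> {in B `&` children x, phi =1 h}).
Proof.
move=> xy; have [[Bx yE]|nBx] := pselect (B x /\ y = h x); last first.
  have [phi] := card_eq_set_bij h (cardP xy).
  by exists phi; split=> // Bx yE; case: nBx.
have [||||phi phiP phih] :=
  extend_set_bij (F := B `&` children x) (h := h) (cardP xy).
- by apply: sub_finite_set finB => z [].
- by move=> z [].
- move=> z [Bz [lz pz]]; split.
    by rewrite partial_iso_level// lz xy.
  by rewrite -h_parent// pz.
- by move=> u v; rewrite !in_setE => -[Bu _] [Bv _]; apply: hI; rewrite in_setE.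
by exists phi.
Qed.

(** The extension g sends a child y of x to phi x (g x) y, where phi x (g x) is
    the bijection of [children_bij]; it is bijective and agrees with h by
    induction on the level. *)
Lemma extend_partial_iso : exists g : T -> T,
  [/\ set_bij setT setT g, forall x, g (parent x) = parent (g x)
    & {in B, g =1 h}].
Proof.
have [phi phiP] : exists phi : T -> T -> T -> T, forall x y, lev x = lev y ->
    set_bij (children x) (children y) (phi x y) /\
    (B x -> y = h x -> {in B `&` children x, phi x y =1 h}).
  have /choice[phi phiP] : forall xy : T * T, exists phi, lev xy.1 = lev xy.2 ->
    set_bij (children xy.1) (children xy.2) phi /\
    (B xy.1 -> xy.2 = h xy.1 -> {in B `&` children xy.1, phi =1 h}).
    move=> [x y] /=; have [xy|nxy] := pselect (lev x = lev y); last by exists h.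
    by have [phi phiP] := children_bij xy; exists phi.
  by exists (fun x y => phi (x, y)) => x y; apply: (phiP (x, y)).
(* The recursion is on the level of the argument, passed separately as k. *)
pose gk := fix gk k x :=
  if k is j.+1 then phi (parent x) (gk j (parent x)) x else x.
pose g x := gk (lev x) x.
have gS x y : children x y -> g y = phi x (g x) y.
  by rewrite /g => -[-> yx] /=; rewrite yx.
have g0 x : lev x = 0 -> g x = x by rewrite /g => ->.
have glev : forall x, lev (g x) = lev x.
  apply: level_ind => [x x0|x y xy IHx]; first by rewrite g0.
  have [[fX _ _] _] := phiP x (g x) (esym IHx).
  by rewrite (gS _ _ xy); have [-> _] := fX _ xy; rewrite IHx; case: xy.
have gchild x y : children x y -> children (g x) (g y).
  move=> xy; have [[fX _ _] _] := phiP x (g x) (esym (glev x)).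
  by rewrite (gS _ _ xy); apply: fX.
have g_parent x : g (parent x) = parent (g x).
  move: x; apply: level_ind => [x x0|x y xy _].
    by rewrite !parent_root// glev.
  by have [_ ->] := gchild _ _ xy; case: xy => _ ->.
exists g; split=> //.
- split=> // [|y _].
    move=> x + _ _; move: x; apply: level_ind => [x x0|x y xy IHx] z gz.
      by apply: rootP; rewrite // -glev -gz glev.
    have xz : children x z.
      split; first by rewrite -glev -gz glev; case: xy.
      by apply/esym/IHx; rewrite g_parent -gz -g_parent; case: xy => _ ->.
    have [[_ fI _] _] := phiP x (g x) (esym (glev x)).
    by apply: fI; rewrite ?in_setE// -!gS.
  move: y; apply: level_ind => [y y0|y z yz [x _ xy]].
    by exists y; rewrite ?g0.
  have [[_ _ fS] _] := phiP x y (etrans (esym (glev x)) (congr1 lev xy)).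
  have [w xw wz] := fS _ yz.
  by exists w => //; rewrite (gS _ _ xw) xy.
move=> x; rewrite in_setE; move: x; apply: level_ind => [x x0|x y xy IHx] By.
  by rewrite g0//; apply: rootP => //; rewrite partial_iso_level.
have Bx : B x by case: xy => _ <-; apply: B_parent.
rewrite (gS _ _ xy).
have [_ ->//] := phiP x (g x) (esym (glev x)); first by rewrite IHx.
by rewrite in_setE.
Qed.

End Extension.
End LevelledTree.

(** * The tree of classes as a levelled tree *)

Section NestedEquivalences.
Variables (n : nat) (A : Type) (E : 'I_n -> A -> A -> Prop).
Hypotheses (equivE : forall i, Equivalence (E i)) (nestedE : is_nested E).

Definition node_level (x : tree_node E) : nat := level x.

Lemma erel_refl i a : erel E i a a.
Proof. by have [refl _ _] := erel_equiv equivE i; apply: refl. Qed.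

Lemma erel_sym i a b : erel E i a b -> erel E i b a.
Proof. by have [_ sym _] := erel_equiv equivE i; apply: sym. Qed.

Lemma erel_ord (i : 'I_n) a b : erel E i.+1 a b = E i a b.
Proof. by rewrite /erel valK. Qed.

Lemma erel_last i a b : n < i -> erel E i a b = (a = b).
Proof. by case: i => // i ni; rewrite /erel insubF// ltnNge -ltnS ni. Qed.

Lemma node_eqP (i : 'I_n.+2) a b : node E i a = node E i b <-> erel E i a b.
Proof.
split=> [[] iab|iab]; last by apply: eq_tree_node => //=; apply: eclass_eq.
by have : eclass E i b b := erel_refl i b; rewrite -iab.
Qed.

Lemma nodeP (x : tree_node E) : exists a, x = node E (level x) a.
Proof. by have [a xa] := node_classP x; exists a; apply: eq_tree_node. Qed.

Lemma level_pred (x : tree_node E) :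
  node_level (tree_pred x) = (node_level x).-1.
Proof.
have [a ->] := nodeP x; rewrite tree_pred_node// /node_level /= inordK//.
exact: leq_ltn_trans (leq_pred _) (ltn_ord _).
Qed.

Lemma root_unique (x y : tree_node E) :
  node_level x = 0 -> node_level y = 0 -> x = y.
Proof.
have [a ->] := nodeP x; have [b ->] := nodeP y; rewrite /node_level /= => x0 y0.
have -> : level y = level x by apply: val_inj; rewrite /= x0 y0.
by apply/node_eqP; rewrite x0.
Qed.

Notation tree_children := (children node_level (@tree_pred n A E)).

Lemma node_class_children (i : 'I_n.+2) a : i <= n ->
  subclasses E i a = @node_class n A E @` tree_children (node E i a).
Proof.
move=> le_in; have iS : i.+1 < n.+2 by [].
have predS b : tree_pred (node E (Ordinal iS) b) = node E i b.
  by rewrite tree_pred_node//=; congr node; apply: val_inj; rewrite /= inordK.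
apply/seteqP; split=> [_ [b ab <-]|_ [y [ly py] <-]].
  exists (node E (Ordinal iS) b) => //; split=> //.
  by rewrite predS; apply/node_eqP/erel_sym.
have [b yb] := nodeP y; have lyS : level y = Ordinal iS by apply: val_inj.
rewrite yb lyS predS in py *; exists b => //=.
by apply/erel_sym/node_eqP.
Qed.

Lemma card_children (i : 'I_n.+2) a : i <= n ->
  tree_children (node E i a) #= subclasses E i a.
Proof.
move=> le_in; rewrite node_class_children// card_eq_sym; apply: inj_card_eq.
move=> x y; rewrite !in_setE => -[lx _] [ly _] xy; apply: eq_tree_node => //.
by apply: val_inj; rewrite /= [LHS]lx [RHS]ly.
Qed.

Lemma children_leaf x : node_level x = n.+1 -> tree_children x = set0.
Proof.
move=> lx; apply/seteqP; split=> // y [+ _]; rewrite lx => ly.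
by have := ltn_ord (level y); rewrite [nat_of_ord _]ly ltnn.
Qed.

(** * Finite partial isomorphisms of the tree *)

Lemma tree_isoP (B C : set (tree E)) (h : tree E -> tree E) :
  isomorphism B C h <->
  set_bij B C h /\ (forall x, B x -> h (tree_pred x) = tree_pred (h x)).
Proof.
split=> [[hB hf _]|[hB hp]].
  split=> // x Bx; have := hf tt [tuple x].
  by rewrite /= theadE => -> // i; rewrite ord1 (tnth_nth x).
split=> // -[] t Bt /=; rewrite hp; last exact: Bt.
by rewrite /thead tnth_map.
Qed.

Lemma tree_substructureP (B : set (tree E)) :
  is_substructure B <-> forall x, B x -> B (tree_pred x).
Proof.
split=> [subB x Bx|predB [] t Bt /=]; last exact/predB/Bt.
have := subB tt [tuple x]; rewrite /= theadE; apply=> i.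
by rewrite ord1 (tnth_nth x).
Qed.

Lemma generated_substructure (L : language) (M : structure L) (X : set M) :
  is_substructure (generated X).
Proof.
move=> f t Xt D /= [subD XD]; apply: (subD) => i.
exact: (Xt i D (conj subD XD)).
Qed.

Notation nodes X := [set node E i a | i in setT & a in X].

Lemma pred_nodes (X : set A) (x : tree_node E) :
  nodes X x -> nodes X (tree_pred x).
Proof.
move=> [i _ [a Xa <-]]; exists (inord i.-1) => //.
by exists a; rewrite ?tree_pred_node.
Qed.

(** Every node lies on the path from the root to some leaf; choosing one such
    leaf for each generator, the finitely many nodes on these paths form a
    substructure that contains the generators. *)
Lemma finite_generated_tree (X : set (tree E)) :
  finite_set X -> finite_set (generated X).
Proof.
move=> finX.
have /choice[rep repP] := nodeP.
have finN : finite_set (nodes (rep @` X)).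
  by apply: finite_image2 => //; apply: finite_image.
apply: sub_finite_set finN; apply: smallest_sub.
  by apply/tree_substructureP => x; apply: pred_nodes.
by move=> x Xx; exists (level x) => //; exists (rep x); [exists x|rewrite -repP].
Qed.

Lemma tree_ultrahomogeneous_of_cardinals :
  (forall i, i <= n -> exists k, forall a, subclasses E i a #= card_rep k) ->
  ultrahomogeneous (tree E).
Proof.
move=> cardE B C h [X finX BX] _ /tree_isoP[[_ hI _] hp].
have finB : finite_set B by rewrite BX; apply: finite_generated_tree.
have predB : forall x, B x -> B (tree_pred x).
  by apply/tree_substructureP; rewrite BX; apply: generated_substructure.
have card_ch x y : node_level x = node_level y ->
    tree_children x #= tree_children y.
  move=> xy; have := ltn_ord (level x).
  rewrite ltnS leq_eqVlt => /predU1P[lx|lx].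
    by rewrite !children_leaf// -xy.
  have [k kP] := cardE _ lx; have [a xa] := nodeP x; have [b yb] := nodeP y.
  have eyx : level y = level x by apply: val_inj; rewrite /= [RHS]xy.
  rewrite xa yb eyx; apply: card_eq_trans (card_children _ lx) _.
  apply: card_eq_trans (kP a) _; rewrite card_eq_sym.
  exact: card_eq_trans (card_children _ lx) (kP b).
have [g [gbij gp gh]] :=
  extend_partial_iso level_pred root_unique predB hI hp card_ch finB.
by exists g => //; apply/tree_isoP.
Qed.

(** * Points as leaves of the tree *)

(** The index i also covers E_0, which is trivial, and equality, which a
    bijection preserves and reflects. *)
Lemma eqstr_isoP (B C : set (eqstr E)) (h : eqstr E -> eqstr E) :
  isomorphism B C h <->
  set_bij B C h /\
  (forall i x y, B x -> B y -> erel E i x y <-> erel E i (h x) (h y)).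
Proof.
split=> [[hB _ hr]|[hB hE]]; last first.
  split=> // r t Bt /=.
  by rewrite !tnth_map -!erel_ord; apply: hE; apply: Bt.
split=> // i x y Bx By; case: i => [//|j] /=.
case: (insubP 'I_n j) => [k _ _|_].
  have := hr k [tuple x; y]; apply=> i.
  by rewrite (tnth_nth x); case: i => -[|[]].
split=> [->//|hxy]; have [_ hI _] := hB.
by apply: hI; rewrite ?in_setE.
Qed.

Lemma fg_eqstrP (B : set (eqstr E)) : fg_substructure B <-> finite_set B.
Proof.
have genE X : generated (M := eqstr E) X = X by apply: smallest_id; case.
by split=> [[X finX ->]|finB]; [rewrite genE|exists B; rewrite ?genE].
Qed.

(** Induction from a leaf down to the root. *)
Lemma ord_pred_ind (m : nat) (P : 'I_m.+1 -> Prop) :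
  P ord_max -> (forall i : 'I_m.+1, P i -> P (inord i.-1)) -> forall i, P i.
Proof.
move=> Pmax Ppred i.
suff Psub k : P (inord (m - k)).
  by have := Psub (m - i); rewrite subKn ?leq_ord// inord_val.
elim: k => [|k IHk].
  by rewrite subn0 -[m in inord m]/(val (@ord_max m)) inord_val.
by have := Ppred _ IHk; rewrite inordK ?ltnS ?leq_subr// subnS.
Qed.

Notation leaf := (node E ord_max).

Lemma leaf_inj a b : leaf a = leaf b -> a = b.
Proof. by rewrite -(@erel_last n.+1 a b)// => /node_eqP. Qed.

Lemma leafP x : node_level x = n.+1 -> exists a, x = leaf a.
Proof.
move=> lx; have [a ->] := nodeP x; exists a; congr node.
exact: val_inj.
Qed.

Lemma fg_nodes (X : set A) :
  finite_set X -> fg_substructure (M := tree E) (nodes X).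
Proof.
move=> finX; exists [set leaf a | a in X]; first exact: finite_image.
apply/seteqP; split=> [_ [i _ [a Xa <-]]|].
  move: i; apply: ord_pred_ind => [|i].
    by apply: sub_gen_smallest; exists a.
  rewrite -tree_pred_node//.
  move: (node E i a); apply/tree_substructureP.
  exact: generated_substructure.
apply: smallest_sub => [|_ [a Xa <-]]; last by exists ord_max => //; exists a.
by apply/tree_substructureP => x; apply: pred_nodes.
Qed.

(** The class [b]_i with b in B is sent to [h b]_i.  This is well defined and
    injective because h preserves and reflects every E_i. *)
Lemma nodes_iso (B C : set (eqstr E)) (h : eqstr E -> eqstr E) :
  isomorphism B C h -> exists2 H : tree E -> tree E,
    isomorphism (M := tree E) (nodes B) (nodes C) H &
    forall i b, B b -> H (node E i b) = node E i (h b).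
Proof.
move=> /eqstr_isoP[[hf hI hS] hE].
have /choice[H HE] : forall x : tree E, exists y, forall i b,
    B b -> x = node E i b -> y = node E i (h b).
  move=> x; have [[i [b Bb ->]]|nx] :=
    pselect (exists i, exists2 b, B b & x = node E i b).
    exists (node E i (h b)) => j c Bc ij.
    have eij : i = j := congr1 (@level _ _ _) ij; rewrite -eij in ij *.
    by apply/node_eqP/(hE i b c Bb Bc)/node_eqP.
  by exists x => i b Bb xb; case: nx; exists i, b.
have {}HE i b : B b -> H (node E i b) = node E i (h b) by move=> Bb; apply: HE.
exists H => //; apply/tree_isoP; split; last first.
  by move=> _ [i _ [b Bb <-]]; rewrite tree_pred_node// !HE// tree_pred_node.
split=> [_ [i _ [b Bb <-]]|x y|_ [i _ [c Cc <-]]].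
- by rewrite HE//; exists i => //; exists (h b) => //; apply: hf.
- rewrite !in_setE => -[i _ [b Bb <-]] [j _ [c Bc <-]].
  rewrite !HE// => ij; have eij : i = j := congr1 (@level _ _ _) ij.
  by rewrite -eij in ij *; apply/node_eqP/(hE i b c Bb Bc)/node_eqP.
- have [b Bb <-] := hS _ Cc.
  by exists (node E i b); [exists i => //; exists b|rewrite HE].
Qed.

(** G preserves levels, hence permutes the leaves, and commutes with taking
    ancestors: it sends [a]_i to [g a]_i.  Since E_i is equality of ancestors at
    level i, injectivity of G makes g preserve and reflect E_i. *)
Lemma tree_automorphism_leaves (G : tree E -> tree E) : automorphism G ->
  exists2 g : eqstr E -> eqstr E, automorphism g &
    forall a, G (leaf a) = leaf (g a).
Proof.
move=> /tree_isoP[[_ GI GS] Gpred].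
have Glev x : node_level (G x) = node_level x.
  exact: (partial_iso_level level_pred root_unique (B := setT)).
have G_inj : injective G by move=> x y; apply: GI; rewrite in_setE.
have /choice[g gE] : forall a, exists b, G (leaf a) = leaf b.
  by move=> a; apply: leafP; rewrite Glev.
have {}gE a : forall i, G (node E i a) = node E i (g a).
  apply: ord_pred_ind => // i Gi.
  by rewrite -!tree_pred_node// Gpred// Gi.
exists g => //; apply/eqstr_isoP; split.
  split=> // [a b _ _ gab|b _].
    by apply: leaf_inj; apply: G_inj; rewrite !gE gab.
  have [x _ xb] := GS (leaf b) I.
  have [a xa] : exists a, x = leaf a by apply: leafP; rewrite -Glev xb.
  by exists a => //; apply: leaf_inj; rewrite -gE -xa.
move=> i a b _ _; have [lt_i|gt_i] := ltnP i n.+2.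
  have erelE x y := node_eqP (Ordinal lt_i) x y.
  rewrite -[erel E i a b]erelE -[erel E i (g a) _]erelE -!gE.
  by split=> [->//|/G_inj].
rewrite !erel_last ?(ltnW gt_i)//; split=> [->//|gab].
by apply: leaf_inj; apply: G_inj; rewrite !gE gab.
Qed.

Lemma eqstr_ultrahomogeneous_of_tree :
  ultrahomogeneous (tree E) -> ultrahomogeneous (eqstr E).
Proof.
move=> tree_hom B C h /fg_eqstrP finB /fg_eqstrP finC /nodes_iso[H isoH HE].
have [G /tree_automorphism_leaves[g autg gE] GH] :=
  tree_hom _ _ _ (fg_nodes finB) (fg_nodes finC) isoH.
exists g => // b; rewrite in_setE => Bb; apply: leaf_inj.
by rewrite -gE GH ?HE// in_setE; exists ord_max => //; exists b.
Qed.

(** * Counting subclasses *)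

Lemma cardinals_of_ultrahomogeneous (countA : countable [set: A]) :
  ultrahomogeneous (eqstr E) ->
  forall i, exists k, forall a, subclasses E i a #= card_rep k.
Proof.
move=> eqstr_hom i.
have eq_card a b : subclasses E i a #= subclasses E i b.
  have sub1 x : fg_substructure (M := eqstr E) [set x] by exact/fg_eqstrP.
  have iso1 : isomorphism (M := eqstr E) [set a] [set b] (fun=> b).
    apply/eqstr_isoP; split.
      split=> // [x y|x -> /=]; last by exists a.
      by rewrite !in_setE => -> ->.
    by move=> j x y -> ->; split=> _; apply: erel_refl.
  have [g /eqstr_isoP[[_ gI gS] gE] gab] :=
    eqstr_hom _ _ _ (sub1 a) (sub1 b) iso1.
  have {}gab : g a = b by apply: gab; rewrite in_setE.
  have g_eclass j x : g @` eclass E j x = eclass E j (g x).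
    apply/seteqP; split=> [_ [y xy <-]|y]; first by rewrite /eclass /= -gE.
    have [z _ <-] := gS y I; rewrite /eclass /= -gE// => xz; by exists z.
  (* The bijection between the sets of subclasses is the direct image by g. *)
  have -> : subclasses E i b = (fun C => g @` C) @` subclasses E i a.
    rewrite /subclasses -gab -g_eclass !image_comp.
    by apply: eq_imagel => y _ /=; rewrite g_eclass.
  rewrite card_eq_sym; apply: inj_card_eq => C D _ _ CD.
  have g_inj : injective g by move=> x y; apply: gI; rewrite in_setE.
  by apply/funext => x; rewrite -(image_inj g_inj) CD image_inj.
(* The value of k is immaterial when A is empty. *)
have [[a _]|A0] := pselect ([set: A] !=set0); last first.
  by exists None => a; case: A0; exists a.
have [/finite_setP[m am]|inf] := pselect (finite_set (subclasses E i a)).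
  by exists (Some m) => b; apply: card_eq_trans (eq_card b a) am.
exists None => b; apply: card_eq_trans (eq_card b a) _; apply: eq_card_nat => //.
apply: sub_countable (card_image_le _ _) _.
exact: sub_countable (card_leT _) countA.
Qed.

End NestedEquivalences.

Theorem theorem8p4 (n : nat) (A : Type) (E : 'I_n -> A -> A -> Prop)
    (equivE : forall i : 'I_n, Equivalence (E i))
    (nestedE : is_nested E)
    (countA : countable [set: A]) :
  [<-> ultrahomogeneous (eqstr E);
       forall i : nat, (i <= n)%N ->
         exists k : option nat,
           forall a : A, subclasses E i a #= card_rep k;
       ultrahomogeneous (tree E)].
Proof.
tfae.
- by move=> eqstr_hom i _; apply: cardinals_of_ultrahomogeneous.
- exact: tree_ultrahomogeneous_of_cardinals.
- exact: eqstr_ultrahomogeneous_of_tree.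
Qed.
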